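(* Let $\lambda>0$, $0<\alpha\le 1$ and $0<\nu\le 1$. Consider the system of difference-differential equations governing the state probabilities $p^\alpha_\nu(n,t)$ of the space and time fractional Poisson process, $$\partial_t^\alpha p^\alpha_\nu(n,t)=-\lambda^\nu\sum_{r=0}^{n}(-1)^r\frac{(\nu)_r}{r!}\,p^\alpha_\nu(n-r,t),\qquad n=0,1,2,\ldots,$$ with initial conditions $p^\alpha_\nu(0,0)=1$ and $p^\alpha_\nu(n,0)=0$ for $n\ge 1$. The solution of this system is $$p^\alpha_\nu(n,t)=\frac{(-1)^n}{n!}\sum_{k=0}^{\infty}\frac{(-\lambda^\nu t^\alpha)^k}{\Gamma(k\alpha+1)}\,\frac{\Gamma(k\nu+1)}{\Gamma(k\nu+1-n)},\qquad n\ge 0,\ t\ge 0.$$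
   Context: $(\nu)_r=\nu(\nu-1)\cdots(\nu-r+1)$ is the falling factorial, with $(\nu)_0=1$. $\partial_t^\alpha$ is the Caputo fractional derivative: for $0<\alpha<1$, $\partial_t^\alpha f(t)=\frac{1}{\Gamma(1-\alpha)}\int_0^t(t-s)^{-\alpha}f'(s)\,ds$, and $\partial_t^1f(t)=f'(t)$. Solutions are real functions of $t$ that are continuous on $[0,\infty)$ and continuously differentiable on $(0,\infty)$ with derivative integrable near $0$; the equations hold for $t>0$. The function $1/\Gamma$ is taken to be $0$ at non-positive integers, so $\Gamma(k\nu+1)/\Gamma(k\nu+1-n)=(k\nu)_n=k\nu(k\nu-1)\cdots(k\nu-n+1)$. *)

(* Defs.v *)
From HB Require Import structures.
From mathcomp Require Import all_boot all_order all_algebra.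
From mathcomp Require Import all_classical all_reals all_analysis.

Set Implicit Arguments.
Unset Strict Implicit.
Unset Printing Implicit Defensive.

Import Order.TTheory GRing.Theory Num.Theory.
Import numFieldNormedType.Exports.

Local Open Scope classical_set_scope.
Local Open Scope ring_scope.

(* Euler's integral; meaningful for 0 < x only. *)
Definition Gamma (R : realType) (x : R) : R :=
  \int[lebesgue_measure]_(s in `]0, +oo[) (s `^ (x - 1) * expR (- s)).

(* 1 / Gamma on the whole real line, extended from the positive half-line by
   1 / Gamma(x) = x (x + 1) ... (x + m - 1) / Gamma(x + m).  Since
   m > `|x|, we have x + m > 0, and the product contains the
   factor 0 exactly when x is a non-positive integer. *)
Definition rGamma (R : realType) (x : R) : R :=
  let m := (Num.truncn `|x|).+1 in (\prod_(i < m) (x + i%:R)) / Gamma (x + m%:R).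

Definition falling (R : realType) (x : R) (r : nat) : R :=
  \prod_(i < r) (x - i%:R).

Definition caputo (R : realType) (a : R) (f : R -> R) (t : R) : R :=
  if a == 1 then derive1 f t
  else (Gamma (1 - a))^-1 *
       \int[lebesgue_measure]_(s in `]0, t[) ((t - s) `^ (- a) * derive1 f s).

(* Values of f at negative arguments are irrelevant. *)
Definition admissible (R : realType) (f : R -> R) : Prop :=
  [/\ {within `[0, +oo[, continuous f},
      forall t, 0 < t -> derivable f t 1,
      forall t, 0 < t -> {for t, continuous (derive1 f)} &
      exists2 e : R, 0 < e &
        lebesgue_measure.-integrable `]0, e[ (EFin \o derive1 f)].

Definition is_solution (R : realType) (lambda alpha nu : R)
    (p : nat -> R -> R) : Prop :=
  [/\ forall n, admissible (p n),
      forall n t, 0 < t ->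
        caputo alpha (p n) t =
        - lambda `^ nu *
          \sum_(r < n.+1) (-1) ^+ r * (falling nu r / r`!%:R) * p (n - r)%N t,
      p 0%N 0 = 1 &
      forall n, (1 <= n)%N -> p n 0 = 0].

Definition stfpp_term (R : realType) (lambda alpha nu : R) (n : nat) (t : R)
    (k : nat) : R :=
  (- lambda `^ nu * t `^ alpha) ^+ k / Gamma (k%:R * alpha + 1) *
  (Gamma (k%:R * nu + 1) * rGamma (k%:R * nu + 1 - n%:R)).

Definition stfpp_prob (R : realType) (lambda alpha nu : R) (n : nat) (t : R) : R :=
  (-1) ^+ n / n`!%:R * limn (series (stfpp_term lambda alpha nu n t)).

(* Main.v *)
Require Import Defs.
From mathcomp Require Import all_boot all_order all_algebra.
From mathcomp Require Import all_classical all_reals all_analysis.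
From mathcomp Require Import measurable_realfun ring lra.

Import Order.TTheory GRing.Theory Num.Theory.
Import numFieldNormedType.Exports.

Local Open Scope classical_set_scope.
Local Open Scope ring_scope.

(** The idea. Write [b (x, n)] for the generalised binomial coefficient
[x (x - 1) ... (x - n + 1) / n!]. The claimed solution is
[p n t = F_n (t ^ alpha)], where [F_n] is the power series with coefficients
[(-1)^n b (k nu, n) (- lambda^nu)^k / Gamma (k alpha + 1)].

Existence. The Caputo derivative of order [alpha] acts on the functions
[t^(k alpha) / Gamma (k alpha + 1)] as a shift of [k]: this is Euler's formula
[B (a, b) = Gamma a Gamma b / Gamma (a + b)] for the beta integral
([Gamma_beta], [beta_convE]), obtained from Tonelli's theorem applied to
[Gamma a Gamma b] written as a double integral. Since [Gamma (k alpha + 1)]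
grows faster than any geometric sequence ([Gamma_ge]) while the other factors
grow at most geometrically, [F_n] is entire; so it can be differentiated
termwise, and dominated convergence, with the beta kernel as dominating
function, justifies termwise integration in the Caputo derivative
([caputo_psum_powR]). The differential system then reduces, coefficient by
coefficient, to the identity
[b (nu + k nu, n) = sum_(r <= n) b (nu, r) b (k nu, n - r)] of Vandermonde
([gbinom_Vandermonde], [stfpp_coefS]).

Uniqueness. By induction on [n], the difference [y] of the components of index
[n] of two solutions satisfies [caputo alpha y = - lambda^nu y] and [y 0 = 0].
The Caputo derivative is nonnegative at a point [t > 0] where [y] attains its
maximum over [[0, t]] ([caputo_ge0_at_max]): integrate by parts and use that the
kernel [(t - s)^(- alpha)] increases with [s]. So [y] has no positive maximum
over any [[0, T]], and exchanging the two solutions gives [y = 0]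
([relaxation_le0], [solution_unique]). *)

(** * Affine change of variables *)

Section affine.
Context {R : realType}.
Local Notation mu := (@lebesgue_measure R).
Local Open Scope ereal_scope.

(** The image of Lebesgue measure under [x |-> c * x + d], multiplied by [c],
gives every interval its length, hence it is Lebesgue measure. Translations and
dilations are both instances. *)
Lemma ge0_integral_affine (f : R -> \bar R) (c d : R) : (0 < c)%R ->
  measurable_fun [set: R] f -> (forall x, 0 <= f x) ->
  \int[mu]_x f x = c%:E * \int[mu]_x f (c * x + d)%R.
Proof.
move=> c0 mf f0.
pose phi : R -> measurableTypeR R := fun x => (c * x + d)%R.
have mphi : measurable_fun [set: R] phi.
  by apply: measurable_funD => //; exact: measurable_funM.
pose k : {nonneg R} := NngNum (ltW c0).
pose m : {measure set (measurableTypeR R) -> \bar R} :=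
  mscale k (measure_function_pushforward__canonical__measure_function_Measure mu mphi).
transitivity (\int[m]_x f x).
  apply: eq_measure_integral => A mA _.
  apply: (@lebesgue_measure_unique R m) => // _ [[a b]] _ <-.
  rewrite /m /mscale /= /pushforward.
  rewrite [X in _ = _ * mu X](_ : _ = `](a - d) / c, (b - d) / c]%classic%R);
    last first.
    apply/seteqP; split => x; rewrite /= !in_itv /= /phi ltr_pdivrMr// ler_pdivlMr//; lra.
  rewrite !lebesgue_measure_itv /= !lte_fin ltr_pM2r ?invr_gt0// ltrD2r.
  case: ifPn => _; last by rewrite mule0.
  rewrite -!EFinB -EFinM; congr EFin; field; exact: lt0r_neq0.
rewrite ge0_integral_mscale//= ge0_integral_pushforward//.
Qed.
End affine.

(** * Integrals of powers near zero *)

Section power.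
Context {R : realType}.
Local Notation mu := (@lebesgue_measure R).

Lemma cvg_div_nat_right (t : R) : 0 < t ->
  (fun n => t / n.+2%:R) @ \oo --> 0^'+.
Proof.
move=> t0; pose u n : R := t / n.+2%:R.
have cu0 : u @ \oo --> (0 : R).
  apply/cvgrPdist_lt => e e0; near=> n.
  rewrite sub0r normrN gtr0_norm ?divr_gt0// /u.
  rewrite ltr_pdivrMr// mulrC -ltr_pdivrMr//.
  rewrite (@lt_trans _ _ n%:R)// ?ltr_nat//.
  by near: n; exact: nbhs_infty_gtr.
move=> P /cu0; rewrite /nbhs/= /nbhs/=; apply: filterS => n /=.
by apply; rewrite divr_gt0.
Unshelve. all: by end_near. Qed.

(** For [a < 1] the integrand is unbounded at [0], so that the fundamental
theorem of calculus is applied on [[u n, t]] with [u n] decreasing to [0]. *)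
Lemma integral_powR (a t : R) : 0 < a -> 0 < t ->
  (\int[mu]_(x in `]0%R, t[) (x `^ (a - 1))%:E = (t `^ a / a)%:E)%E.
Proof.
move=> a0 t0.
have mf (D : set R) : measurable_fun D (fun x : R => (x `^ (a - 1))%:E).
  by apply/measurable_EFinP; apply: measurable_funTS; exact: measurable_powR.
pose u n : R := t / n.+2%:R.
have u0 n : 0 < u n by rewrite divr_gt0.
have ut n : u n < t by rewrite ltr_pdivrMr// ltr_pMr// ltr1n.
have cvgu : u @ \oo --> 0^'+ by exact: cvg_div_nat_right.
have int_cc n : (\int[mu]_(x in `[u n, t]) (x `^ (a - 1))%:E =
    (t `^ a / a - u n `^ a / a)%:E)%E.
  rewrite EFinB; apply: (@continuous_FTC2 _ _ (fun x => x `^ a / a)) => //.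
  - apply: derivable_within_continuous => x; rewrite in_itv/= => /andP[ux _].
    by apply: derivable_powR; rewrite in_itv/= andbT (lt_le_trans (u0 n)).
  - have dv x : 0 < x -> derivable (fun x => x `^ a / a) x 1.
      move=> x0; apply: derivableM => //; apply: derivable_powR.
      by rewrite in_itv/= andbT.
    have cv x : 0 < x -> {for x, continuous (fun x => x `^ a / a)}.
      by move=> x0; apply: differentiable_continuous; exact/derivable1_diffP/dv.
    split => [x||].
    + by rewrite in_itv/= => /andP[ux _]; apply: dv; exact: lt_trans ux.
    + apply: cvg_at_right_filter.
      exact: cv.
    + apply: cvg_at_left_filter.
      exact: cv.
  - move=> x; rewrite in_itv/= => /andP[ux _].
    have x0 : 0 < x by exact: lt_trans ux.
    have := is_derive1_powR a x0 => H.
    rewrite derive1E derive_val scaler0 add0r.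
    by rewrite /GRing.scale/=; field; exact: lt0r_neq0.
have -> : `]0, t[%classic = \bigcup_n `[u n, t[%classic.
  apply/seteqP; split => x /=; rewrite in_itv/=.
    move=> /andP[x0 xt].
    have [n _ /(_ n (leqnn n)) /= un] : \forall n \near \oo, u n < x.
      exact: cvgu _ (nbhs_right_lt x0).
    by exists n => //=; rewrite in_itv/= xt (ltW un).
  move=> [n ? /=]; rewrite in_itv/= => /andP[ux ->]; rewrite andbT; exact: lt_le_trans ux.
apply: (@cvg_unique _ _
  ((fun n => \int[mu]_(x in `[u n, t[) (x `^ (a - 1))%:E)%E @ \oo)) => //=.
  apply: ge0_nondecreasing_set_cvg_integral => //=.
  - apply/nondecreasing_seqP => n; apply/subsetPset; apply: subset_itvr.
    by rewrite bnd_simp ler_pM2l// lef_pV2 ?posrE// ler_nat.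
  - by move=> n; exact: mf.
  - by move=> n x _; rewrite lee_fin powR_ge0.
under eq_cvg => n do rewrite integral_itv_bndo_bndc// int_cc.
apply: cvg_EFin; first exact: nearW.
rewrite -[X in _ --> X]subr0; apply: cvgB; first exact: cvg_cst.
rewrite -(mul0r a^-1); apply: cvgM; last exact: cvg_cst.
exact: (cvg_comp _ _ cvgu (powR_cvg0 a0)).
Unshelve. all: by end_near. Qed.
End power.

(** * Euler's integral *)

Section GammaBasics.
Context {R : realType}.
Local Notation mu := (@lebesgue_measure R).

(** The integrand is dominated by [s^(a - 1)] on [[0, 1]], and by a multiple of
the density of an exponential law of rate [1/2] beyond [1]. *)
Lemma Gamma_integrable (a : R) : 0 < a ->
  mu.-integrable `]0, +oo[ (fun s => (s `^ (a - 1) * expR (- s))%:E).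
Proof.
move=> a0.
have mpow (D : set R) (b : R) : measurable_fun D (fun x : R => (x `^ b)%:E).
  by apply/measurable_EFinP; apply: measurable_funTS; exact: measurable_powR.
have [n an] : exists n : nat, a <= n%:R.
  by exists (Num.truncn a).+1; rewrite ltW// truncnS_gt.
(* From the term of degree n.+1 in the series of exp (s / 2). *)
pose C : R := 2 ^+ n.+1 * n.+1`!%:R.
have C0 : 0 < C by rewrite mulr_gt0// ?exprn_gt0// ltr0n fact_gt0.
have powC s : 1 <= s -> s `^ (a - 1) <= C * expR (s / 2).
  move=> s1; have s0 : 0 <= s by exact: le_trans s1.
  apply: (@le_trans _ _ (s ^+ n.+1)).
    rewrite -powR_mulrn//; apply: ler_powR => //; lra.
  have : 1 + (s / 2) ^+ n.+1 / n.+1`!%:R <= expR (s / 2).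
    by apply: expR_ge1Dxn; rewrite divr_ge0.
  rewrite exprMn exprVn => H.
  have -> : s ^+ n.+1 = C * (s ^+ n.+1 / 2 ^+ n.+1 / n.+1`!%:R).
    rewrite /C; field; rewrite pnatr_eq0 -lt0n fact_gt0/= expf_neq0//.
  rewrite ler_pM2l//; lra.
pose g1 := (fun s : R => (s `^ (a - 1))%:E) \_ `]0, 1[.
pose g2 := EFin \o exponential_pdf (2^-1 : R).
have ig1 : mu.-integrable setT g1.
  apply: (integrable_mkcond _ _).1 => //; apply/integrableP.
  split; first exact: (mpow _ (a - 1)).
  under eq_integral do rewrite /= ger0_norm ?powR_ge0//.
  by rewrite integral_powR// ltry.
have ig2 : mu.-integrable setT g2 by exact: integrable_exponential_pdf.
have ig : mu.-integrable setT (fun s => g1 s + (2 * C)%:E * g2 s)%E.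
  by apply: integrableD => //; exact: integrableZl.
have ig' : mu.-integrable `]0%R, +oo[ (fun s => g1 s + (2 * C)%:E * g2 s)%E.
  exact: integrableS ig.
apply: le_integrable ig' => //.
- apply/measurable_EFinP; apply: measurable_funM.
    by apply: measurable_funTS; exact: measurable_powR.
  by apply: measurable_funTS; apply: measurableT_comp => //; exact: measurable_expR.
- move=> s /=; rewrite in_itv/= andbT => s0.
  rewrite /g1 /g2 patchE /= mem_setE in_itv/= s0/=.
  rewrite exponential_pdfE ?(ltW s0)// ger0_norm ?mulr_ge0 ?powR_ge0 ?expR_ge0//.
  have E : expR (- s) = expR (- (s / 2)) * expR (- (s / 2)).
    by rewrite -expRD; congr expR; lra.
  have E2 : expR (s / 2) * expR (- (s/2)) = 1 by rewrite expRxMexpNx_1.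
  have e0 := expR_gt0 (-(s/2)).
  have eq : - 2^-1 * s = - (s / 2) by lra.
  have p0 : 0 <= s `^ (a - 1) by exact: powR_ge0.
  rewrite eq; case: ifPn => [s1|].
    rewrite -EFinM -EFinD /=. rewrite lee_fin ger0_norm; last by nra.
    have : expR (-s) <= 1 by rewrite expR_le1 lerNl oppr0 ltW.
    nra.
  rewrite -leNgt => s1; have := powC s s1 => H.
  rewrite [point](_ : _ = 0%E)// add0e -EFinM /= lee_fin ger0_norm; last by nra.
  have He : s `^ (a - 1) * expR (- (s / 2)) <= C.
    by have := ler_wpM2r (ltW e0) H; rewrite -mulrA E2 mulr1.
  rewrite E mulrA (_ : 2 * C * _ = C * expR (- (s / 2))); last by field.
  by rewrite ler_pM2r.
Qed.

Lemma Gamma_EFin (a : R) : 0 < a ->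
  (\int[mu]_(s in `]0%R, +oo[) (s `^ (a - 1) * expR (- s))%:E = (Gamma a)%:E)%E.
Proof.
move=> a0; rewrite /Gamma /Rintegral fineK//.
by apply: integrable_fin_num => //; exact: Gamma_integrable.
Qed.


Lemma Gamma1 : Gamma 1 = 1 :> R.
Proof.
have [mE _] := integrableP _ _ _ (@Gamma_integrable 1 ltr01).
apply: EFin_inj; rewrite -Gamma_EFin// -(@integral_exponential_pdf R 1 ltr01).
rewrite integral_itv_obnd_cbnd// integral_mkcond.
apply: eq_integral => x _; rewrite /exponential_pdf !patchE.
by case: ifPn => // _; rewrite subrr powRr0 mul1r mulN1r mul1r.
Qed.

Lemma Gamma_ge0 (a : R) : 0 <= Gamma a.
Proof. by apply: Rintegral_ge0 => s _; rewrite mulr_ge0 ?powR_ge0 ?expR_ge0. Qed.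

(** Only the mass of [[A, A + 1]] is kept. As [A] is arbitrary, [Gamma] grows
faster than any geometric sequence. *)
Lemma Gamma_ge (x A : R) : 0 <= x -> 0 < A ->
  A `^ x * expR (- (A + 1)) <= Gamma (x + 1).
Proof.
move=> x0 A0; rewrite -lee_fin -Gamma_EFin; last lra.
apply: (@le_trans _ _
  (\int[mu]_(s in `[A, (A + 1)%R]) (A `^ x * expR (- (A + 1)))%:E)%E).
  rewrite integral_cst//= lebesgue_measure_itv/= lte_fin ltrDl ltr01 -EFinB.
  by rewrite -EFinM lee_fin; nra.
have [mE _] := integrableP _ _ _ (@Gamma_integrable (x + 1) ltac:(lra)).
have sub : `[A, A + 1]%classic `<=` `]0, +oo[%classic.
  by move=> s /=; rewrite !in_itv/= andbT => /andP[As _]; exact: lt_le_trans As.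
apply: (@le_trans _ _
  (\int[mu]_(s in `[A, (A + 1)%R]) (s `^ (x + 1 - 1) * expR (- s))%:E)%E).
  apply: ge0_le_integral => //.
  - by move=> s _; rewrite lee_fin mulr_ge0 ?powR_ge0 ?expR_ge0.
  - exact: measurable_funS mE.
  - move=> s /=; rewrite in_itv/= => /andP[As sA]; rewrite lee_fin.
    rewrite addrK ler_pM ?powR_ge0 ?expR_ge0//; last by rewrite ler_expR lerN2.
    by apply: ge0_ler_powR; rewrite ?nnegrE//; lra.
apply: ge0_subset_integral => //.
by move=> s _; rewrite lee_fin mulr_ge0 ?powR_ge0 ?expR_ge0.
Qed.

Lemma Gamma_gt0_ge1 (x : R) : 1 <= x -> 0 < Gamma x.
Proof.
move=> x1; rewrite -(subrK 1 x).
apply: lt_le_trans (@Gamma_ge (x - 1) 1 _ ltr01); last lra.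
by rewrite powR1 mul1r expR_gt0.
Qed.

End GammaBasics.

(** * The beta integral *)

Section Beta.
Context {R : realType}.
Local Notation mu := (@lebesgue_measure R).
Local Open Scope ereal_scope.

(** Convolution at [t] of two power functions: the beta integral when [t = 1],
and, up to a constant, the fractional derivative of a power when
[b = 1 - alpha]. It is kept in the extended reals until its finiteness is
deduced from that of [Gamma]. *)
Definition beta_conv (a b t : R) : \bar R :=
  \int[mu]_(s in `]0%R, t[) (s `^ (a - 1) * (t - s) `^ (b - 1))%:E.

Lemma measurable_beta_kernel (a b t : R) (D : set R) :
  measurable_fun D (fun s => s `^ (a - 1) * (t - s) `^ (b - 1))%R.
Proof.
apply: measurable_funTS; apply: measurable_funM; first exact: measurable_powR.
apply: (@measurableT_comp _ _ _ _ _ _ (fun x => x `^ (b - 1))%R).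
  exact: measurable_powR.
exact: measurable_funB.
Qed.

(** Substitute [s = t * x]. *)
Lemma beta_conv_scale (a b t : R) : (0 < t)%R ->
  beta_conv a b t = (t `^ (a + b - 1))%:E * beta_conv a b 1%R.
Proof.
move=> t0; rewrite /beta_conv integral_mkcond.
rewrite (ge0_integral_affine _ t 0%R t0); last 2 first.
- apply/(measurable_restrictT _ _).1 => //; apply/measurable_EFinP.
  exact: measurable_beta_kernel.
- by move=> x; apply: erestrict_ge0 => s _; rewrite lee_fin mulr_ge0 ?powR_ge0.
rewrite [in RHS]integral_mkcond.
have -> : (t `^ (a + b - 1))%:E = t%:E * (t `^ (a + b - 1 - 1))%:E.
  rewrite -EFinM; congr EFin.
  rewrite -[X in (X * _)%R]powRr1 ?ltW// -powRD ?(gt_eqF t0) ?implybT//.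
  by congr powR; lra.
rewrite -muleA; congr (_ * _).
rewrite -ge0_integralZl//; last 3 first.
- apply/(measurable_restrictT _ _).1 => //; apply/measurable_EFinP.
  exact: measurable_beta_kernel.
- move=> x _; apply: erestrict_ge0 => s _.
  by rewrite lee_fin mulr_ge0 ?powR_ge0.
- by rewrite lee_fin powR_ge0.
apply: eq_integral => x _; rewrite addr0 !patchE.
have E : ((t * x)%R \in `]0%R, t[%classic) = (x \in `]0%R, 1%R[%classic).
  by rewrite !mem_setE !in_itv/= pmulr_rgt0// gtr_pMr.
rewrite E; case: ifPn => [|_]; last by rewrite mule0.
rewrite inE/= in_itv/= => /andP[x0 x1]; rewrite -EFinM; congr EFin.
have -> : (t - t * x = t * (1 - x))%R by lra.
rewrite !powRM ?ltW//; last lra.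
have -> : (a + b - 1 - 1 = (a - 1) + (b - 1))%R by lra.
rewrite (@powRD _ t (a - 1) (b - 1)) ?(gt_eqF t0) ?implybT//. ring.
Qed.

Let phi (a : R) : R -> R := (fun s => s `^ (a - 1) * expR (- s))%R \_ `]0%R, +oo[.

Let phi_ge0 a x : (0 <= phi a x)%R.
Proof. by apply: restrict_ge0 => s _; rewrite mulr_ge0 ?powR_ge0 ?expR_ge0. Qed.

Let measurable_phi a : measurable_fun setT (phi a).
Proof.
apply/(measurable_restrictT _ _).1 => //; apply: measurable_funTS.
apply: measurable_funM; first exact: measurable_powR.
by apply: measurableT_comp => //; exact: measurable_expR.
Qed.

Let integral_phi a : (0 < a)%R -> \int[mu]_x (phi a x)%:E = (Gamma a)%:E.
Proof.
move=> a0; rewrite -Gamma_EFin// [RHS]integral_mkcond; apply: eq_integral => x _.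
by rewrite /phi !patchE; case: ifPn.
Qed.

(** The exponential factors multiply to [expR (- u)], which leaves the
convolution of the two powers over [[0, u]]. *)
Let integral_phi_conv a b u :
  \int[mu]_x (phi a x * phi b (u - x))%:E = (phi (a + b) u)%:E * beta_conv a b 1%R.
Proof.
have [u0|u0] := ltP 0%R u; last first.
  rewrite [phi (a + b) u]/phi patchE ifF; last first.
    by apply/negP; rewrite inE/= in_itv/= andbT => /lt_geF; rewrite u0.
  rewrite [point](_ : _ = 0%R)// mul0e integral0_eq// => x _.
  rewrite /phi !patchE !mem_setE !in_itv/= !andbT.
  case: ifPn => [x0|]; last by rewrite mul0r.
  by case: ifPn => [?|_]; [exfalso; lra | rewrite mulr0].
rewrite {3}/phi patchE ifT; last by rewrite inE/= in_itv/= u0.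
have -> : (u `^ (a + b - 1) * expR (- u))%:E * beta_conv a b 1%R =
    (expR (- u))%:E * beta_conv a b u.
  by rewrite (beta_conv_scale _ _ _ u0) EFinM muleAC muleC.
rewrite /beta_conv [in RHS]integral_mkcond -ge0_integralZl//; last 2 first.
- apply/(measurable_restrictT _ _).1 => //; apply/measurable_EFinP.
  exact: measurable_beta_kernel.
- move=> x _; apply: erestrict_ge0 => s _.
  by rewrite lee_fin mulr_ge0 ?powR_ge0.
apply: eq_integral => x _; rewrite /phi !patchE !mem_setE !in_itv/= !andbT subr_gt0.
case: ifPn => [x0|] /=; last by rewrite mul0r mule0.
case: ifPn => [|xu] /=; last by rewrite mulr0 mule0.
rewrite -EFinM => xu; congr EFin.
have -> : expR (- u) = (expR (- x) * expR (- (u - x)))%R.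
  by rewrite -expRD; congr expR; lra.
lra.
Qed.

(** [Gamma a * Gamma b] is the integral of the convolution of the two integrands,
by Tonelli's theorem and invariance under translations. *)
Lemma Gamma_beta (a b : R) : (0 < a)%R -> (0 < b)%R ->
  (Gamma a)%:E * (Gamma b)%:E = (Gamma (a + b))%:E * beta_conv a b 1%R.
Proof.
move=> a0 b0.
have beta0 : 0 <= beta_conv a b 1%R.
  by apply: integral_ge0 => s _; rewrite lee_fin mulr_ge0 ?powR_ge0.
have mphi2 : measurable_fun setT (fun z : R * R => (phi a z.1 * phi b (z.2 - z.1))%:E).
  apply/measurable_EFinP; apply: measurable_funM.
    by apply: measurableT_comp => //; exact: measurable_phi.
  apply: (measurableT_comp (measurable_phi b)); exact: measurable_funB.
transitivity (\int[mu]_x \int[mu]_u (phi a x * phi b (u - x))%:E).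
  rewrite -(integral_phi a a0) -ge0_integralZr//; last 3 first.
  - by apply/measurable_EFinP; exact: measurable_phi.
  - by move=> x _; rewrite lee_fin phi_ge0.
  - by rewrite lee_fin Gamma_ge0.
  apply: eq_integral => x _.
  under eq_integral do rewrite EFinM.
  rewrite ge0_integralZl//; last 3 first.
  - apply/measurable_EFinP; apply: (measurableT_comp (measurable_phi b)).
    exact: measurable_funB.
  - by move=> u _; rewrite lee_fin phi_ge0.
  - by rewrite lee_fin phi_ge0.
  congr (_ * _); rewrite -integral_phi//.
  rewrite (ge0_integral_affine (EFin \o phi b) 1 (- x)%R ltr01)//.
  - by rewrite mul1e; apply: eq_integral => u _; rewrite mul1r.
  - by apply/measurable_EFinP; exact: measurable_phi.
  - by move=> u; rewrite lee_fin phi_ge0.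
transitivity (\int[mu]_u \int[mu]_x (phi a x * phi b (u - x))%:E).
  have := @fubini_tonelli _ _ _ _ R mu mu
    (fun z : R * R => (phi a z.1 * phi b (z.2 - z.1))%:E) mphi2.
  apply.
  by move=> z; rewrite lee_fin mulr_ge0 ?phi_ge0.
under eq_integral do rewrite integral_phi_conv.
rewrite ge0_integralZr// ?integral_phi ?addr_gt0//.
- by apply/measurable_EFinP; exact: measurable_phi.
- by move=> x _; rewrite lee_fin phi_ge0.
Qed.

(** The case [b = 1] of [Gamma_beta], where the beta integral is [1 / x]. *)
Lemma GammaS (x : R) : (0 < x)%R -> Gamma (x + 1) = (x * Gamma x)%R.
Proof.
move=> x0; have := Gamma_beta x 1 x0 ltr01.
have -> : beta_conv x 1 1%R = (x^-1)%:E.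
  have := @integral_powR R x 1 x0 ltr01; rewrite powR1 mul1r => <-.
  by apply: eq_integral => s _; rewrite subrr powRr0 mulr1.
rewrite Gamma1 -!EFinM => -[]; rewrite mulr1 => ->.
by rewrite mulrCA divff ?mulr1// gt_eqF.
Qed.

Lemma Gamma_gt0 (x : R) : (0 < x)%R -> (0 < Gamma x)%R.
Proof.
move=> x0; have : (0 < Gamma (x + 1))%R by apply: Gamma_gt0_ge1; lra.
by rewrite GammaS// pmulr_rgt0.
Qed.

Lemma beta_convE (a b t : R) : (0 < a)%R -> (0 < b)%R -> (0 < t)%R ->
  beta_conv a b t = (t `^ (a + b - 1) * (Gamma a * Gamma b / Gamma (a + b)))%:E.
Proof.
move=> a0 b0 t0; rewrite beta_conv_scale// EFinM; congr (_ * _).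
have G0 : (0 < Gamma (a + b))%R by apply: Gamma_gt0; lra.
have := Gamma_beta a b a0 b0; rewrite -EFinM => H.
rewrite mulrC EFinM H muleA -EFinM mulVf ?mul1e//; exact: lt0r_neq0.
Qed.

Lemma beta_conv_integrable (a b t : R) : (0 < a)%R -> (0 < b)%R -> (0 < t)%R ->
  mu.-integrable `]0%R, t[ (fun s => (s `^ (a - 1) * (t - s) `^ (b - 1))%:E).
Proof.
move=> a0 b0 t0; apply/integrableP; split.
  by apply/measurable_EFinP; exact: measurable_beta_kernel.
under eq_integral do rewrite /= ger0_norm ?mulr_ge0 ?powR_ge0//.
by have := beta_convE a b t a0 b0 t0; rewrite /beta_conv => ->; exact: ltry.
Qed.

End Beta.

(** * Power series with infinite radius of convergence *)

Section Entire.
Context {R : realType}.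
Implicit Types (c d : nat -> R) (z : R).

(** Coefficients of an entire function. This growth condition, equivalent to the
convergence of the series everywhere, passes at once to the coefficients of the
derivative. *)
Definition entire c := forall r : R, 0 < r -> exists C : R, forall k, `|c k| * r ^+ k <= C.

Lemma entire_pseries_diffs c : entire c -> entire (pseries_diffs c).
Proof.
move=> rc r r0; have [C HC] := rc (2 * r) (mulr_gt0 (ltr0Sn _ 1) r0).
exists (C / r) => k; rewrite ler_pdivlMr// /pseries_diffs normrM normr_nat.
apply: le_trans (HC k.+1).
rewrite exprMn [leRHS]mulrCA -!mulrA -exprSr ler_wpM2r ?mulr_ge0 ?exprn_ge0 ?(ltW r0)//.
rewrite -natrX ler_nat ltnW//; exact: ltn_expl.
Qed.

(** Apply the growth condition with [r] at least twice [`|z|], which gains a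
factor [2^-1 ^+ k]. *)
Lemma entire_le c z : entire c ->
  exists2 C : R, 0 <= C & forall k, `|c k * z ^+ k| <= C * 2^-1 ^+ k.
Proof.
move=> rc; pose r := 2 * (`|z| + 1); have z0 := normr_ge0 z.
have r0 : 0 < r by rewrite /r; lra.
have [C HC] := rc r r0.
exists C => [|k]; first by apply: le_trans (HC 0%N); rewrite expr0 mulr1.
rewrite exprVn ler_pdivlMr ?exprn_gt0//; apply: le_trans (HC k).
rewrite normrM normrX -mulrA ler_wpM2l ?normr_ge0// -exprMn.
by apply: lerXn2r; rewrite ?nnegrE /r; lra.
Qed.

Lemma entire_cvg_norm c z : entire c -> cvgn [series `|c k * z ^+ k|]_k.
Proof.
move=> /(entire_le _ z) [C C0 HC].
apply: series_le_cvg HC _ => [//|k|]; first by rewrite mulr_ge0 ?exprn_ge0.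
by apply: is_cvg_geometric_series; rewrite ger0_norm; lra.
Qed.

Lemma entire_cvg c z : entire c -> cvgn (pseries c z).
Proof. by move=> rc; apply: normed_cvg; exact: entire_cvg_norm. Qed.

Definition psum c (z : R) : R := limn (pseries c z).

Lemma entire_is_derive c z : entire c ->
  is_derive z 1 (psum c) (psum (pseries_diffs c) z).
Proof.
move=> rc; apply: (@pseries_snd_diffs _ _ (`|z| + 1)).
- exact: entire_cvg.
- exact/entire_cvg/entire_pseries_diffs.
- exact/entire_cvg/entire_pseries_diffs/entire_pseries_diffs.
- by rewrite [ltRHS]ger0_norm; have := normr_ge0 z; lra.
Qed.

Lemma entire_continuous c : entire c -> continuous (psum c).
Proof.
move=> rc z; apply: differentiable_continuous; apply/derivable1_diffP.
by have [] := entire_is_derive c z rc.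
Qed.

Definition geom_bounded d := exists C D : R, forall k, `|d k| <= C * D ^+ k.

(** [Gamma (k a + 1)] eventually exceeds [E ^ k] for every [E], by [Gamma_ge]. *)
Lemma geom_bounded_entire_Gamma (a : R) d : 0 < a -> geom_bounded d ->
  entire (fun k => d k / Gamma (k%:R * a + 1)).
Proof.
move=> a0 [C [D dCD]] r r0.
(* With this A, the bound A ^ (k a) of Gamma_ge is E ^ k, and E exceeds D r. *)
pose E := `|D| * r + 1; pose A := E `^ a^-1.
have E0 : 0 < E by rewrite ltr_wpDl// mulr_ge0// ltW.
have A0 : 0 < A by exact: powR_gt0.
have Gk k : E ^+ k * expR (- (A + 1)) <= Gamma (k%:R * a + 1).
  have -> : E ^+ k = A `^ (k%:R * a).
    by rewrite /A -powRrM mulrCA mulVf ?gt_eqF// mulr1 powR_mulrn// ltW.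
  by apply: Gamma_ge => //; rewrite mulr_ge0// ltW.
exists (`|C| * expR (A + 1)) => k.
have e0 := expR_gt0 (- (A + 1)).
have G0 : 0 < Gamma (k%:R * a + 1).
  by apply: lt_le_trans (Gk k); rewrite mulr_gt0// exprn_gt0.
rewrite normrM normfV [`|Gamma _|]gtr0_norm// mulrAC ler_pdivrMr//.
apply: (@le_trans _ _ (`|C| * E ^+ k)).
  apply: (@le_trans _ _ (`|C| * `|D| ^+ k * r ^+ k)).
    rewrite ler_wpM2r ?exprn_ge0 ?(ltW r0)// (le_trans (dCD k))//.
    by rewrite (le_trans (ler_norm _))// normrM normrX.
  rewrite -mulrA ler_wpM2l// -exprMn lerXn2r ?nnegrE ?(ltW E0) ?mulr_ge0 ?(ltW r0)//.
  by rewrite /E lerDl.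
rewrite -mulrA ler_wpM2l//.
apply: le_trans (ler_wpM2l (expR_ge0 (A + 1)) (Gk k)).
by rewrite mulrCA expRxMexpNx_1 mulr1.
Qed.

Lemma geom_boundedS d : geom_bounded d -> geom_bounded (fun k => d k.+1).
Proof.
by move=> [C [D H]]; exists (C * D), D => k; rewrite -mulrA -exprS.
Qed.

End Entire.

(** * Caputo derivatives of power series in a fractional power *)

Section Caputo.
Context {R : realType}.
Local Notation mu := (@lebesgue_measure R).
Implicit Types (c d : nat -> R) (a t : R).

(** The bound is common to the sum and to all partial sums: it dominates the
partial sums when they are integrated. *)
Lemma entire_bounded c (r : R) : entire c ->
  exists M : R, forall z, `|z| <= r ->
    (forall n, `|pseries c z n| <= M) /\ `|psum c z| <= M.
Proof.
move=> rc; have [C C0 HC] := entire_le c r rc.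
exists (C * 2) => z zr.
have zn n : `|pseries c z n| <= C * 2.
  apply: le_trans (ler_norm_sum _ _ _) _.
  apply: (@le_trans _ _ (\sum_(0 <= k < n) C * 2^-1 ^+ k)).
    apply: ler_sum => k _; apply: le_trans (HC k).
    rewrite !normrM !normrX ler_wpM2l// lerXn2r ?nnegrE//.
    exact: le_trans zr (ler_norm r).
  rewrite -mulr_sumr ler_wpM2l// (_ : \sum_(0 <= k < n) _ = 2 - 2 * 2^-1 ^+ n).
    by rewrite gerBl mulr_ge0 ?exprn_ge0.
  elim: n => [|n IH]; first by rewrite big_nil expr0; lra.
  by rewrite big_nat_recr//= IH exprS; lra.
split => //; rewrite ler_norml; apply/andP; split.
  apply: limr_ge; first exact: entire_cvg.
  by apply: nearW => n; have := zn n; rewrite ler_norml => /andP[].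
apply: limr_le; first exact: entire_cvg.
by apply: nearW => n; have := zn n; rewrite ler_norml => /andP[].
Qed.

Lemma is_derive_psum_powR c a t : entire c -> 0 < t ->
  is_derive t 1 (fun s => psum c (s `^ a))
    (psum (pseries_diffs c) (t `^ a) * (a * t `^ (a - 1))).
Proof.
move=> rc t0.
exact: (@is_derive1_comp _ (psum c) (fun s => s `^ a) t _ _
  (entire_is_derive c _ rc) (is_derive1_powR a t0)).
Qed.

Lemma derive1_psum_powR c a t : entire c -> 0 < t ->
  derive1 (fun s => psum c (s `^ a)) t =
  psum (pseries_diffs c) (t `^ a) * (a * t `^ (a - 1)).
Proof.
move=> rc t0; rewrite derive1E.
by have [_ ->] := is_derive_psum_powR c a t rc t0.
Qed.

Lemma continuous_powR a t : 0 < t -> {for t, continuous (fun s : R => s `^ a)}.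
Proof.
move=> t0; apply: differentiable_continuous; apply/derivable1_diffP.
by have [] := is_derive1_powR a t0.
Qed.

Lemma continuous_psum_powR c a t : entire c -> 0 < t ->
  {for t, continuous (fun s => psum c (s `^ a))}.
Proof.
move=> rc t0; apply: (@continuous_comp _ _ _ (fun s : R => s `^ a) (psum c)).
  exact: continuous_powR.
exact: entire_continuous.
Qed.

Lemma continuous_derive1_psum_powR c a t : entire c -> 0 < t ->
  {for t, continuous (derive1 (fun s => psum c (s `^ a)))}.
Proof.
move=> rc t0.
pose g s := psum (pseries_diffs c) (s `^ a) * (a * s `^ (a - 1)).
have cg : {for t, continuous g}.
  apply: continuousM; first by apply: continuous_psum_powR => //; exact: entire_pseries_diffs.
  by apply: continuousM; [exact: cst_continuous|exact: continuous_powR].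
rewrite /prop_for /continuous_at derive1_psum_powR//.
apply: cvg_trans cg; apply: near_eq_cvg; near=> s.
rewrite derive1_psum_powR//; near: s; exact: lt_nbhsr.
Unshelve. all: by end_near. Qed.

(** Near [0] the derivative is a bounded function times [s^(a - 1)], which is
integrable because [a > 0]. *)
Lemma admissible_psum_powR c a : entire c -> 0 < a ->
  admissible (fun s => psum c (s `^ a)).
Proof.
move=> rc a0; split.
- apply/continuous_within_itvcyP; split.
    by move=> x; rewrite in_itv/= andbT; exact: continuous_psum_powR.
  rewrite powR0 ?gt_eqF//.
  apply: (cvg_comp _ _ (powR_cvg0 a0)); exact: entire_continuous.
- by move=> t t0; have [] := is_derive_psum_powR c a t rc t0.
- by move=> t; exact: continuous_derive1_psum_powR.
exists 1 => //.
have [M HM] := entire_bounded (pseries_diffs c) 1 (entire_pseries_diffs _ rc).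
have ipow : mu.-integrable `]0, 1[ (fun s => (s `^ (a - 1))%:E).
  apply/integrableP; split.
    by apply/measurable_EFinP; apply: measurable_funTS; exact: measurable_powR.
  under eq_integral do rewrite /= ger0_norm ?powR_ge0//.
  by rewrite integral_powR// ltry.
apply: le_integrable (integrableZl _ (M * a) ipow) => //.
  apply/measurable_EFinP; apply: open_continuous_measurable_fun => //.
  move=> x; rewrite inE/= in_itv/= => /andP[x0 _]; exact: continuous_derive1_psum_powR.
move=> s /=; rewrite in_itv/= => /andP[s0 s1].
rewrite lee_fin derive1_psum_powR// normrM -mulrA [leRHS]normrM ler_wpM2r//.
apply: le_trans (ler_norm _); apply: (HM _ _).2.
rewrite ger0_norm ?powR_ge0// -[leRHS](_ : 1 `^ a = 1); last by rewrite powR1.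
by apply: ge0_ler_powR; rewrite ?nnegrE//; lra.
Qed.

(** On [t^(k a) / Gamma (k a + 1)] the Caputo derivative is a shift of [k]. For
[a < 1] this is [beta_convE] with the exponents [k a] and [1 - a]; the series is
integrated termwise by dominated convergence. *)
Lemma caputo_psum_powR a d t : 0 < a -> a <= 1 -> geom_bounded d -> 0 < t ->
  caputo a (fun s => psum (fun k => d k / Gamma (k%:R * a + 1)) (s `^ a)) t =
  psum (fun k => d k.+1 / Gamma (k%:R * a + 1)) (t `^ a).
Proof.
move=> a0 a1 gd t0.
set c := fun k => d k / _.
have rc : entire c by exact: geom_bounded_entire_Gamma.
have rdc := entire_pseries_diffs c rc.
have G0 (k : nat) : 0 < Gamma (k%:R * a + 1).
  by apply: Gamma_gt0; rewrite ltr_wpDl// mulr_ge0// ltW.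
have ka0 (k : nat) : 0 < k.+1%:R * a by rewrite mulr_gt0.
have diffsE k : pseries_diffs c k * a = d k.+1 / Gamma (k.+1%:R * a).
  rewrite /pseries_diffs /c GammaS//.
  have := lt0r_neq0 (Gamma_gt0 _ (ka0 k)).
  have kn : k.+1%:R != 0 :> R by rewrite pnatr_eq0.
  move: kn; move: (Gamma _) => g; move: k.+1%:R => q qn gn.
  by field; rewrite gn qn gt_eqF.
rewrite /caputo; case: eqVneq => [a1E|a1N].
  rewrite derive1_psum_powR// a1E subrr powRr0 mulr1 mulr1; congr psum.
  apply/funext => k; rewrite -[LHS]mulr1 -[X in _ * X = _]a1E diffsE a1E !mulr1.
  by rewrite -natr1.
have {}a1 : a < 1 by rewrite lt_neqAle a1N.
have b0 : 0 < 1 - a by lra.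
(* The derivative of the k-th power, times (t - s)^(- a), is K times the k-th
   power up to a factor; K is integrable as a beta kernel. *)
pose K s : R := s `^ (a - 1) * (t - s) `^ (1 - a - 1).
have iK : mu.-integrable `]0, t[ (EFin \o K) by exact: beta_conv_integrable.
pose F n s : R := pseries (pseries_diffs c) (s `^ a) n * (a * K s).
have mK : measurable_fun setT K by exact: measurable_beta_kernel.
have mpow (b : R) : measurable_fun setT (fun s : R => s `^ b) by exact: measurable_powR.
have [M HM] := entire_bounded (pseries_diffs c) (t `^ a) rdc.
pose L := Gamma (1 - a) * psum (fun k => d k.+1 / Gamma (k%:R * a + 1)) (t `^ a).
have intF n : (\int[mu]_(s in `]0%R, t[) (F n s)%:E =
    (Gamma (1 - a) * pseries (fun k => d k.+1 / Gamma (k%:R * a + 1)) (t `^ a) n)%:E)%E.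
  transitivity (\int[mu]_(s in `]0%R, t[) \sum_(0 <= k < n)
     ((pseries_diffs c k * a)%:E * (s `^ (k.+1%:R * a - 1) * (t - s) `^ (1 - a - 1))%:E))%E.
    apply: eq_integral => s; rewrite inE/= in_itv/= => /andP[s0 _].
    under eq_bigr do rewrite -EFinM.
    rewrite sumEFin; congr EFin; rewrite /F /pseries /series/= mulr_suml.
    apply: eq_bigr => k _; rewrite /K.
    have -> : k.+1%:R * a - 1 = a * k%:R + (a - 1) by rewrite -natr1; ring.
    rewrite (@powRD _ s (a * k%:R) (a - 1)) ?(gt_eqF s0) ?implybT// powRrM.
    by rewrite powR_mulrn ?powR_ge0//; ring.
  rewrite integral_sum//; last first.
    by move=> k; apply: integrableZl => //; exact: beta_conv_integrable.
  rewrite /pseries /series/= mulr_sumr -sumEFin; apply: eq_bigr => k _.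
  rewrite integralZl//; last exact: beta_conv_integrable.
  have := beta_convE (k.+1%:R * a) (1 - a) t (ka0 k) b0 t0; rewrite /beta_conv => ->.
  rewrite -EFinM diffsE; congr EFin.
  have -> : k.+1%:R * a + (1 - a) - 1 = a * k%:R by rewrite -natr1; ring.
  have -> : k.+1%:R * a + (1 - a) = k%:R * a + 1 by rewrite -natr1; ring.
  rewrite powRrM powR_mulrn ?powR_ge0//.
  have := lt0r_neq0 (G0 k); have := lt0r_neq0 (Gamma_gt0 _ (ka0 k)).
  move: (Gamma _) (Gamma (k%:R * a + 1)) (Gamma _) => g1 g2 g3 g1n g2n.
  by field; rewrite g1n g2n.
have lim1 : (\int[mu]_(s in `]0%R, t[) (F n s)%:E @[n --> \oo] --> L%:E)%E.
  under eq_cvg do rewrite intF.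
  apply: cvg_EFin; first exact: nearW.
  apply: cvgM; first exact: cvg_cst.
  by apply: entire_cvg; apply: geom_bounded_entire_Gamma => //; exact: geom_boundedS.
have mF n : measurable_fun setT (F n).
  apply: measurable_funM; last by apply: measurable_funM.
  apply: measurable_sum => k; apply: measurable_funM => //.
  exact: measurable_funX.
have itv_le s : s \in `]0, t[ -> `|s `^ a| <= t `^ a.
  rewrite in_itv/= => /andP[s0 st]; rewrite ger0_norm ?powR_ge0//.
  by apply: ge0_ler_powR; rewrite ?nnegrE//; lra.
pose G s : R := (t - s) `^ (- a) * derive1 (fun s => psum c (s `^ a)) s.
have GE s : s \in `]0, t[ -> G s = psum (pseries_diffs c) (s `^ a) * (a * K s).
  rewrite in_itv/= => /andP[s0 st]; rewrite /G derive1_psum_powR// /K.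
  have -> : 1 - a - 1 = - a by ring.
  ring.
have [_ _ lim2] : [/\ mu.-integrable `]0, t[ (EFin \o G),
    (\int[mu]_(s in `]0%R, t[) `|(F n s)%:E - (G s)%:E| @[n --> \oo] --> 0)%E &
    (\int[mu]_(s in `]0%R, t[) (F n s)%:E @[n --> \oo] -->
       \int[mu]_(s in `]0%R, t[) (G s)%:E)%E].
  apply: (@dominated_convergence _ _ _ mu _ _ (fun n => EFin \o F n) (EFin \o G)
     (fun s => ((M * a)%:E * (EFin \o K) s)%E)) => //.
  - by move=> n; apply/measurable_EFinP; apply: measurable_funTS; exact: mF.
  - apply/measurable_EFinP.
    apply: measurable_funM.
      by apply: measurable_funTS; apply: (measurableT_comp (mpow _)); exact: measurable_funB.
    apply: open_continuous_measurable_fun => //.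
    by move=> x; rewrite inE/= in_itv/= => /andP[x0 _]; exact: continuous_derive1_psum_powR.
  - apply: aeW => s st; apply: cvg_EFin; first exact: nearW.
    rewrite /= GE//; apply: cvgM; last exact: cvg_cst.
    exact: entire_cvg.
  - exact: integrableZl.
  - apply: aeW => s n st; rewrite /= -EFinM lee_fin /F normrM.
    have K0 : 0 <= a * K s by rewrite !mulr_ge0 ?powR_ge0// ltW.
    rewrite (ger0_norm K0) -mulrA ler_wpM2r//; apply: (HM _ _).1; exact: itv_le.
rewrite /Rintegral.
have <- : L%:E = (\int[mu]_(s in `]0%R, t[) (G s)%:E)%E.
  exact: cvg_unique lim1 lim2.
by rewrite /L /= mulKf// gt_eqF// Gamma_gt0.
Qed.
End Caputo.

(** * Linearity of the Caputo derivative *)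

Section Admissible.
Context {R : realType}.
Local Notation mu := (@lebesgue_measure R).
Implicit Types (a t : R) (f g y : R -> R).

Lemma admissible_continuous f t : admissible f -> 0 < t -> {for t, continuous f}.
Proof.
move=> [_ df _ _] t0; apply: differentiable_continuous; apply/derivable1_diffP; exact: df.
Qed.

Lemma admissible_derive1_within f u v : admissible f -> 0 < u ->
  {within `[u, v], continuous (derive1 f)}.
Proof.
move=> [_ _ cf _] u0; apply: continuous_in_subspaceT => x.
rewrite inE/= in_itv/= => /andP[ux _]; apply: cf; exact: lt_le_trans ux.
Qed.

Lemma admissible_derive1_bounded f u v : admissible f -> 0 < u -> u <= v ->
  exists M : R, forall s, s \in `[u, v] -> `|derive1 f s| <= M.
Proof.
move=> af u0 uv.
have [|c _ Hc] := @EVT_max R (fun s => `|derive1 f s|) u v uv.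
  apply: continuous_in_subspaceT => x; rewrite inE/= in_itv/= => /andP[ux _].
  apply: continuous_comp; last exact: norm_continuous.
  by case: af => _ _ cf _; apply: cf; exact: lt_le_trans ux.
by exists `|derive1 f c|.
Qed.

Lemma measurable_admissible_derive1 f (u v : R) : admissible f -> 0 <= u ->
  measurable_fun `]u, v[ (derive1 f).
Proof.
move=> [_ _ cf _] u0; apply: open_continuous_measurable_fun => // x.
rewrite inE/= in_itv/= => /andP[ux _]; apply: cf; exact: le_lt_trans ux.
Qed.

Lemma powR_kernel_integrable a t : a < 1 -> 0 < t ->
  mu.-integrable `]0, t[ (fun s => ((t - s) `^ (- a))%:E).
Proof.
move=> a1 t0; have := @beta_conv_integrable R 1 (1 - a) t ltr01 _ t0.
move=> /(_ ltac:(lra)); congr (mu.-integrable _ _); apply/funext => s.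
by rewrite subrr powRr0 mul1r; congr ((_ `^ _)%:E); ring.
Qed.

(** The two singularities are at opposite ends: near [0] the kernel is bounded
and the derivative is integrable, near [t] the derivative is bounded and the
kernel is integrable. *)
Lemma caputo_integrable a f t : admissible f -> 0 < a -> a < 1 -> 0 < t ->
  mu.-integrable `]0, t[ (fun s => ((t - s) `^ (- a) * derive1 f s)%:E).
Proof.
move=> af a0 a1 t0; have [_ _ _ [e e0 ie]] := af.
pose m := Num.min e t / 2.
have [me [mt m0]] : m < e /\ m < t /\ 0 < m.
  by rewrite /m; case: (ltP e t) => H; (split; [lra|split; lra]).
have [M HM] := admissible_derive1_bounded f m t af m0 (ltW mt).
pose B := (t - m) `^ (- a).
have B0 : 0 <= B by exact: powR_ge0.
pose h1 := (fun s => (derive1 f s)%:E) \_ `]0, m[.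
have ih1 : mu.-integrable `]0, t[ h1.
  apply: (@integrableS _ _ _ _ setT) => //.
  apply: (integrable_mkcond _ _).1 => //.
  apply: integrableS ie => //; apply: subset_itvl; rewrite bnd_simp; exact: ltW.
have ik := powR_kernel_integrable a t a1 t0.
pose h s : \bar R := (B%:E * `|h1 s| + M%:E * ((t - s) `^ (- a))%:E)%E.
have ih : mu.-integrable `]0, t[ h.
  apply: integrableD => //; first by apply: integrableZl => //; exact: integrable_abse.
  exact: integrableZl.
have M0 : 0 <= M.
  by apply: le_trans (HM t _); rewrite ?in_itv/= ?lexx ?(ltW mt).
apply: le_integrable ih => //.
  apply/measurable_EFinP; apply: measurable_funM.
    apply: measurable_funTS.
    apply: (@measurableT_comp _ _ _ _ _ _ (fun x => x `^ (- a))).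
      exact: measurable_powR.
    exact: measurable_funB.
  exact: measurable_admissible_derive1.
move=> s /=; rewrite in_itv/= => /andP[s0 st].
rewrite /h /h1 patchE mem_setE in_itv/= s0/=.
have p0 : 0 <= (t - s) `^ (- a) by exact: powR_ge0.
rewrite normrM (ger0_norm p0).
have df0 := normr_ge0 (derive1 f s).
case: ifPn => [sm|].
  change (((t - s) `^ (- a) * `|derive1 f s|)%:E <=
    (`|B * `|derive1 f s| + M * (t - s) `^ (- a)|)%:E)%E.
  rewrite lee_fin; apply: le_trans (ler_norm _).
  have : (t - s) `^ (- a) <= B.
    rewrite /B !powRN lef_pV2 ?posrE ?powR_gt0 ?subr_gt0//.
    by apply: ge0_ler_powR; rewrite ?nnegrE; lra.
  nra.
rewrite -leNgt => ms; rewrite [point](_ : _ = 0%E)// abse0 mule0 add0e -EFinM /= lee_fin.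
apply: le_trans (ler_norm _); rewrite mulrC ler_wpM2r//.
by apply: HM; rewrite in_itv/= ms ltW.
Qed.

Lemma is_derive_admissible f t : admissible f -> 0 < t -> is_derive t 1 f (derive1 f t).
Proof. by move=> [_ df _ _] t0; split; [exact: df|rewrite derive1E]. Qed.

Lemma derive1_admissibleB f g t : admissible f -> admissible g -> 0 < t ->
  is_derive t 1 (fun s => f s - g s) (derive1 f t - derive1 g t).
Proof.
move=> af ag t0.
exact: (is_deriveB (is_derive_admissible _ _ af t0) (is_derive_admissible _ _ ag t0)).
Qed.

Lemma derive1BE f g t : admissible f -> admissible g -> 0 < t ->
  derive1 (fun s => f s - g s) t = derive1 f t - derive1 g t.
Proof.
by move=> af ag t0; rewrite derive1E; have [_ ->] := derive1_admissibleB _ _ _ af ag t0.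
Qed.

Lemma admissibleB f g : admissible f -> admissible g -> admissible (fun s => f s - g s).
Proof.
move=> af ag; have [cf df cdf [e e0 ie]] := af; have [cg dg cdg [e' e'0 ie']] := ag.
split.
- exact: within_continuousB cf cg.
- by move=> t t0; have [] := derive1_admissibleB f g t af ag t0.
- move=> t t0; rewrite /prop_for /continuous_at derive1BE//.
  have : {for t, continuous (fun s => derive1 f s - derive1 g s)}.
    by apply: continuousB; [exact: cdf|exact: cdg].
  apply: cvg_trans; apply: near_eq_cvg; near=> s.
  by rewrite derive1BE//; near: s; exact: lt_nbhsr.
exists (Num.min e e'); first by rewrite lt_min e0.
have : mu.-integrable `]0, Num.min e e'[ ((EFin \o derive1 f) \- (EFin \o derive1 g))%E.
  apply: integrableB => //.
    by apply: integrableS ie => //; apply: subset_itvl; rewrite bnd_simp ge_min lexx.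
  by apply: integrableS ie' => //; apply: subset_itvl; rewrite bnd_simp ge_min lexx orbT.
apply: eq_integrable => // s; rewrite inE/= in_itv/= => /andP[s0 _].
by rewrite derive1BE.
Unshelve. all: by end_near. Qed.

Lemma caputoB a f g t : admissible f -> admissible g -> 0 < a -> a <= 1 -> 0 < t ->
  caputo a (fun s => f s - g s) t = caputo a f t - caputo a g t.
Proof.
move=> af ag a0 a1 t0; rewrite /caputo; case: eqVneq => [_|aN]; first exact: derive1BE.
have {}a1 : a < 1 by rewrite lt_neqAle aN.
rewrite -mulrBr; congr (_ * _).
rewrite -RintegralB//; last 2 first.
- exact: caputo_integrable.
- exact: caputo_integrable.
apply: eq_Rintegral => s; rewrite inE/= in_itv/= => /andP[s0 _].
by rewrite derive1BE// mulrBr.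
Qed.

End Admissible.

(** * The extremum principle *)

Section Extremum.
Context {R : realType}.
Local Notation mu := (@lebesgue_measure R).
Implicit Types (a t T : R) (y : R -> R).

Lemma admissible_MVT y (u v : R) : admissible y -> 0 < u -> u < v ->
  exists2 c, c \in `]u, v[ & y v - y u = derive1 y c * (v - u).
Proof.
move=> ay u0 uv; apply: MVT => //.
- move=> x; rewrite in_itv/= => /andP[ux _]; apply: is_derive_admissible => //.
  exact: lt_trans ux.
- apply: continuous_in_subspaceT => x; rewrite inE/= in_itv/= => /andP[ux _].
  by apply: admissible_continuous => //; exact: lt_le_trans ux.
Qed.

(** Only values to the left of [T] are compared. If the derivative were negative
at [T], then by continuity it would be negative just before, where [y] would
exceed [y T]. *)
Lemma derive1_ge0_at_max y T : admissible y -> 0 < T ->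
  (forall s, 0 <= s <= T -> y s <= y T) -> 0 <= derive1 y T.
Proof.
move=> ay T0 ymax; rewrite leNgt; apply/negP => dy0.
have [_ _ /(_ T T0) cd _] := ay.
have [e e0 He] : exists2 e : R, 0 < e & forall s, `|T - s| < e -> derive1 y s < 0.
  have : \forall s \near nbhs T, derive1 y s < 0 by exact: cvgr_lt cd _ dy0.
  move=> /nbhs_ballP [e e0 He].
  by exists e => // s; exact: He.
pose u := T - Num.min e T / 2.
have [ue [u0 uT]] : T - u < e /\ 0 < u /\ u < T.
  rewrite /u; case: (ltP e T) => H; (split; [lra|split; lra]).
have [c] := admissible_MVT y u T ay u0 uT.
rewrite in_itv/= => /andP[uc cT].
have := ymax u; have /He : `|T - c| < e by rewrite ger0_norm; lra.
move=> dc /(_ ltac:(lra)) yu E; nra.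
Qed.

(** Integrate by parts, with [y - y t <= 0] as primitive of the derivative of
[y]. Both the boundary term at [u] and the integral against the derivative of the
increasing kernel have the favourable sign; the boundary term at [v] remains. *)
Lemma Rintegral_kernel_ge y a t (u v : R) : admissible y -> 0 < a ->
  0 < u -> u < v -> v < t ->
  (forall s, 0 <= s <= t -> y s <= y t) ->
  - ((t - v) `^ (- a) * (y t - y v)) <=
  \int[mu]_(s in `[u, v]) ((t - s) `^ (- a) * derive1 y s).
Proof.
move=> ay a0 u0 uv vt ymax.
pose K s : R := (t - s) `^ (- a).
pose K' s : R := a * (t - s) `^ (- a - 1).
pose Y s : R := y s - y t.
have dK s : s < t -> is_derive s 1 K (K' s).
  move=> st; have ts : 0 < t - s by lra.
  have d1 : is_derive s 1 (fun s : R => t - s) (0 - 1) by exact: is_deriveB.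
  have d2 := is_derive1_powR (- a) ts.
  have := @is_derive1_comp _ (fun x : R => x `^ (- a)) (fun s : R => t - s) s _ _ d2 d1.
  by rewrite sub0r mulrN1 mulNr opprK.
have cK' s : s < t -> {for s, continuous K'}.
  move=> st; have ts : 0 < t - s by lra.
  apply: continuousM; first exact: cst_continuous.
  apply: (@continuous_comp _ _ _ (fun s : R => t - s) (fun x : R => x `^ (- a - 1))).
    by apply: continuousB; [exact: cst_continuous|exact: cvg_id].
  exact: continuous_powR.
have cK s : s < t -> {for s, continuous K}.
  move=> st; apply: differentiable_continuous; apply/derivable1_diffP.
  by have [] := dK s st.
have dY (s : R) : 0 < s -> is_derive s 1 Y (derive1 y s).
  move=> s0; rewrite -[derive1 y s]subr0; apply: is_deriveB.
  exact: is_derive_admissible.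
have cY (s : R) : 0 < s -> {for s, continuous Y}.
  move=> s0; apply: differentiable_continuous; apply/derivable1_diffP.
  by have [] := dY s s0.
have cKw : {within `[u, v], continuous K'}.
  apply: continuous_in_subspaceT => x; rewrite inE/= in_itv/= => /andP[_ xv].
  by apply: cK'; exact: le_lt_trans vt.
rewrite (@Rintegration_by_parts _ K Y K' (derive1 y) u v uv) => //; last first.
- move=> s; rewrite in_itv/= => /andP[us _]; rewrite derive1E.
  by have [_ ->] := dY s (lt_trans u0 us).
- split => [s||].
  + by rewrite in_itv/= => /andP[us _]; have [] := dY s (lt_trans u0 us).
  + by apply: cvg_at_right_filter; exact: cY.
  + by apply: cvg_at_left_filter; apply: cY; exact: lt_trans uv.
- exact: admissible_derive1_within.
- move=> s; rewrite in_itv/= => /andP[_ sv]; rewrite derive1E.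
  by have [_ ->] := dK s (lt_trans sv vt).
- split => [s||].
  + by rewrite in_itv/= => /andP[_ sv]; have [] := dK s (lt_trans sv vt).
  + by apply: cvg_at_right_filter; apply: cK; exact: lt_trans vt.
  + by apply: cvg_at_left_filter; apply: cK.
have Y0 s : 0 <= s <= t -> Y s <= 0 by move=> /ymax; rewrite subr_le0.
have I0 : 0 <= \int[mu]_(x in `[u, v]) (- (K' x * Y x)).
  apply: Rintegral_ge0 => s; rewrite /= in_itv/= => /andP[us sv].
  rewrite -mulrN mulr_ge0 ?oppr_ge0//.
    by rewrite mulr_ge0 ?powR_ge0// ltW.
  apply: Y0; lra.
have IN : \int[mu]_(x in `[u, v]) (- (K' x * Y x)) = - \int[mu]_(x in `[u, v]) (K' x * Y x).
  rewrite -[RHS]mulN1r -RintegralZl//; last first.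
    apply: continuous_compact_integrable; first exact: segment_compact.
    apply: continuous_in_subspaceT => x; rewrite inE/= in_itv/= => /andP[ux xv].
    apply: continuousM; first by apply: cK'; exact: le_lt_trans vt.
    by apply: cY; exact: lt_le_trans ux.
  by apply: eq_Rintegral => s _; rewrite mulN1r.
rewrite -mulrN opprB -addrA lerDl addr_ge0// -?IN// oppr_ge0.
by rewrite mulr_ge0_le0 ?powR_ge0// Y0// (ltW u0)/= ltW// (lt_trans uv).
Qed.

(** Let [u] tend to [0] and [v] to [t] in [Rintegral_kernel_ge]. The remaining
boundary term is [(t - v)^(- a)] times an increment of order [t - v], since [y] is
continuously differentiable at [t > 0]; as [a < 1], it vanishes in the limit. *)
Lemma caputo_ge0_at_max y a t : admissible y -> 0 < a -> a <= 1 -> 0 < t ->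
  (forall s, 0 <= s <= t -> y s <= y t) -> 0 <= caputo a y t.
Proof.
move=> ay a0 a1 t0 ymax; rewrite /caputo; case: eqVneq => [_|aN].
  exact: derive1_ge0_at_max.
have {}a1 : a < 1 by rewrite lt_neqAle aN.
rewrite mulr_ge0// ?invr_ge0 ?Gamma_ge0//.
pose G s := (t - s) `^ (- a) * derive1 y s.
have iG : mu.-integrable `]0, t[ (EFin \o G) by exact: caputo_integrable.
(* The halving keeps d n below t / 2, so that d n <= t - d n. *)
pose d n : R := t / 2 / n.+2%:R.
have d0 n : 0 < d n by rewrite !divr_gt0.
have dt n : d n < t / 2.
  by rewrite ltr_pdivrMr// ltr_pMr ?divr_gt0// ltr1n.
have cvgd : d @ \oo --> 0^'+ by apply: cvg_div_nat_right; lra.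
pose A n := `[d n, t - d n]%classic.
have sub n : A n `<=` `]0, t[.
  by move=> s; rewrite /A /= !in_itv/= => /andP[s1 s2]; have := d0 n; lra.
have [_ _ lim] : [/\ mu.-integrable `]0, t[ (EFin \o G),
    (\int[mu]_(s in `]0%R, t[) `|((EFin \o G) \_ (A n)) s - (G s)%:E| @[n --> \oo] --> 0)%E &
    (\int[mu]_(s in `]0%R, t[) ((EFin \o G) \_ (A n)) s @[n --> \oo] -->
       \int[mu]_(s in `]0%R, t[) (G s)%:E)%E].
  have mG : measurable_fun `]0, t[ (EFin \o G) by case/integrableP : iG.
  apply: (@dominated_convergence _ _ _ mu _ _ (fun n => (EFin \o G) \_ (A n)) (EFin \o G)
     (abse \o (EFin \o G))) => //.
  - move=> n; apply: (measurable_restrict _ _ _).1 => //; first exact: measurable_itv.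
    by apply: measurable_funS mG => // s [].
  - apply: aeW => s; rewrite /= in_itv/= => /andP[s0 st].
    apply: cvg_near_cst; near=> n; rewrite patchE ifT// mem_setE in_itv/=.
    have : d n < s by near: n; exact: cvgd _ (nbhs_right_lt s0).
    have : d n < t - s by near: n; apply: cvgd _ (nbhs_right_lt _); lra.
    by move=> ? ?; lra.
  - exact: integrable_abse.
  - apply: aeW => s n _; rewrite patchE; case: ifPn => // _.
    by rewrite [point](_ : _ = 0%E)// abse0 abse_ge0.
have limR : (fun n => \int[mu]_(s in A n) G s) @ \oo --> \int[mu]_(s in `]0, t[) G s.
  have -> : (fun n => \int[mu]_(s in A n) G s) =
      fine \o (fun n => (\int[mu]_(s in `]0%R, t[) ((EFin \o G) \_ (A n)) s)%E).
    apply/funext => n /=; rewrite /Rintegral; congr fine.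
    by rewrite -integral_mkcondr (_ : _ `&` _ = A n)//; apply/setIidPr; exact: sub.
  apply: fine_cvg; rewrite /Rintegral fineK//; exact: integrable_fin_num.
have [M HM] := admissible_derive1_bounded y (t / 2) t ay ltac:(lra) ltac:(lra).
have low n : - (M * d n `^ (1 - a)) <= \int[mu]_(s in A n) G s.
  have := dt n => dn; have := d0 n => dn0.
  apply: le_trans (Rintegral_kernel_ge y a t (d n) (t - d n) ay a0 _ _ _ ymax); try lra.
  rewrite lerN2 (_ : t - (t - d n) = d n); last ring.
  have [c] := admissible_MVT y (t - d n) t ay ltac:(lra) ltac:(lra).
  rewrite in_itv/= => /andP[c1 c2] ->.
  have := HM c; rewrite in_itv/= => /(_ ltac:(lra)) Hc.
  rewrite (_ : t - (t - d n) = d n); last ring.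
  rewrite powRD ?(gt_eqF dn0) ?implybT// powRr1 ?(ltW dn0)//.
  have p0 : 0 < d n `^ (- a) by exact: powR_gt0.
  have dp0 : 0 <= d n * d n `^ (- a) by exact: mulr_ge0 (ltW dn0) (ltW p0).
  rewrite [leLHS]mulrC -mulrA ler_wpM2r//.
  exact: le_trans (ler_norm _) Hc.
have lim0 : (fun n => - (M * d n `^ (1 - a))) @ \oo --> (0 : R).
  rewrite -[X in _ --> X]oppr0 -(mulr0 M); apply: cvgN; apply: cvgM; first exact: cvg_cst.
  by apply: (cvg_comp _ _ cvgd (powR_cvg0 _)); lra.
by apply: ler_cvg_to lim0 limR _; apply: nearW.
Unshelve. all: by end_near. Qed.

(** At a positive maximum the equation makes the Caputo derivative negative,
against [caputo_ge0_at_max]. *)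
Lemma relaxation_le0 y a m : admissible y -> 0 < a -> a <= 1 -> 0 < m -> y 0 <= 0 ->
  (forall t, 0 < t -> caputo a y t = - (m * y t)) ->
  forall t, 0 <= t -> y t <= 0.
Proof.
move=> ay a0 a1 m0 y0 yeq t; rewrite le_eqVlt => /predU1P[<-//|t0].
rewrite leNgt; apply/negP => yt.
have [|c] := @EVT_max R y 0 t (ltW t0).
  by case: ay => cy _ _ _; apply: continuous_subspaceW cy; exact: subset_itvl.
rewrite in_itv/= => /andP[c0 ct] ymax.
have yc : 0 < y c by apply: lt_le_trans yt (ymax _ _); rewrite in_itv/= lexx (ltW t0).
have {}c0 : 0 < c.
  by rewrite lt_neqAle c0 andbT; apply: contraTneq yc => <-; rewrite -leNgt.
have : 0 <= caputo a y c.
  apply: caputo_ge0_at_max => // s /andP[s0 sc]; apply: ymax.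
  by rewrite in_itv/= s0; exact: le_trans ct.
by rewrite yeq// oppr_ge0 leNgt mulr_gt0.
Qed.
End Extremum.

(** * Falling factorials and generalised binomial coefficients *)

Section RecipGamma.
Context {R : realType}.
Implicit Types x y : R.

(** By the functional equation of [Gamma], the quotient on the right does not
depend on [n], as long as [x + n] is positive. *)
Lemma rGammaE x n : 0 < x + n%:R ->
  rGamma x = \prod_(i < n) (x + i%:R) / Gamma (x + n%:R).
Proof.
pose P k := \prod_(i < k) (x + i%:R) / Gamma (x + k%:R).
have PD k j : 0 < x + k%:R -> P (k + j)%N = P k.
  move=> xk; elim: j => [|j <-]; first by rewrite addn0.
  have xkj : 0 < x + (k + j)%:R by rewrite natrD addrA ltr_wpDr.
  rewrite /P addnS big_ord_recr/= -natr1 addrA GammaS//.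
  have := lt0r_neq0 (Gamma_gt0 _ xkj); have := lt0r_neq0 xkj.
  move: (Gamma _) => g; move: (x + _) => q q0 g0.
  by rewrite invfM mulrA mulfK.
move=> xn; rewrite /rGamma -/(P _) -/(P n).
have xm : 0 < x + (Num.truncn `|x|).+1%:R.
  have := truncnS_gt `|x|; have := ler_norm (- x); rewrite normrN; lra.
move: (Num.truncn `|x|).+1 xm => m xm.
by case: (leqP m n) => [mn|/ltnW nm];
  [rewrite -(subnKC mn) PD|rewrite -(subnKC nm) PD].
Qed.

Lemma Gamma_rGamma x n : 0 < x + 1 -> Gamma (x + 1) * rGamma (x + 1 - n%:R) = falling x n.
Proof.
move=> x0; rewrite (rGammaE _ n) ?subrK// mulrC divfK; last exact/lt0r_neq0/Gamma_gt0.
rewrite /falling (reindex_inj rev_ord_inj); apply: eq_bigr => i _ /=.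
by rewrite natrB// -natr1; ring.
Qed.

Lemma falling_recr x r : falling x r.+1 = falling x r * (x - r%:R).
Proof. by rewrite /falling big_ord_recr. Qed.

Definition gbinom x r : R := falling x r / r`!%:R.

Lemma gbinom0 x : gbinom x 0 = 1.
Proof. by rewrite /gbinom /falling big_ord0 fact0 divr1. Qed.

Lemma gbinomS x r : r.+1%:R * gbinom x r.+1 = (x - r%:R) * gbinom x r.
Proof.
rewrite /gbinom falling_recr factS natrM invfM.
by rewrite mulrCA mulVKf ?pnatr_eq0// mulrAC mulrC.
Qed.

(** In [n.+1 * sum], split the factor [n.+1] of the term of index [r] as
[r + (n.+1 - r)] and lower one of the two indices by [gbinomS]: each product then
gets the total factor [x + y - n]. *)
Lemma gbinom_Vandermonde x y n :
  \sum_(r < n.+1) gbinom x r * gbinom y (n - r)%N = gbinom (x + y) n.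
Proof.
elim: n => [|n IH]; first by rewrite big_ord1 !gbinom0 mulr1.
have n0 : n.+1%:R != 0 :> R by rewrite pnatr_eq0.
apply: (mulfI n0); rewrite gbinomS -IH.
have -> : n.+1%:R * (\sum_(r < n.+2) gbinom x r * gbinom y (n.+1 - r)%N) =
   \sum_(r < n.+2) (r%:R * gbinom x r) * gbinom y (n.+1 - r)%N +
   \sum_(r < n.+2) gbinom x r * ((n.+1 - r)%:R * gbinom y (n.+1 - r)%N).
  rewrite mulr_sumr -big_split/=; apply: eq_bigr => r _.
  rewrite -mulrA [X in _ = _ + X]mulrCA -mulrDl -natrD subnKC// -ltnS; exact: ltn_ord.
rewrite big_ord_recl/= mul0r mul0r add0r [X in _ + X]big_ord_recr/= subnn mul0r mulr0 addr0.
rewrite -big_split/= mulr_sumr; apply: eq_bigr => r _.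
have rn : (r <= n)%N by rewrite -ltnS.
rewrite /bump leq0n add1n subSS (subSn rn).
rewrite gbinomS gbinomS (natrB _ rn).
move: (gbinom x r) (gbinom y (n - r)%N) (n%:R : R) (r%:R : R) => A B c d; ring.
Qed.

(** Every factor is at most [k + n <= n.+1 * 2 ^ k]: for fixed [n], the falling
factorial grows at most geometrically in [k]. *)
Lemma falling_bound (nu : R) n k : 0 <= nu -> nu <= 1 ->
  `|falling (k%:R * nu) n| <= n.+1%:R ^+ n * (2 ^+ n) ^+ k.
Proof.
move=> nu0 nu1.
rewrite -exprM mulnC exprM -exprMn /falling normr_prod.
have H (i : 'I_n) : `|k%:R * nu - i%:R| <= n.+1%:R * 2 ^+ k.
  apply: (le_trans (ler_normB _ _)); rewrite normr_nat ger0_norm ?mulr_ge0//.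
  apply: (@le_trans _ _ (k%:R + n%:R)).
    by apply: lerD; [rewrite ler_piMr|rewrite ler_nat ltnW].
  rewrite -natrX -natrM -natrD ler_nat mulSn leq_add//.
    by rewrite ltnW// ltn_expl.
  by rewrite leq_pmulr// expn_gt0.
have -> : (n.+1%:R * 2 ^+ k) ^+ n = \prod_(i < n) (n.+1%:R * 2 ^+ k) :> R.
  by rewrite prodr_const card_ord.
by apply: ler_prod => i _; rewrite normr_ge0; exact: H.
Qed.

End RecipGamma.

(** * The explicit solution *)

Section Solution.
Context {R : realType}.
Implicit Types (c d : nat -> R) (t z : R).

Lemma psum_cvg c z l : pseries c z @ \oo --> l -> psum c z = l.
Proof. by move/cvg_lim; apply. Qed.

Lemma cvg_psum c z : entire c -> pseries c z @ \oo --> psum c z.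
Proof. exact: entire_cvg. Qed.

Lemma psum0 c : psum c 0 = c 0%N.
Proof.
apply: psum_cvg; apply: cvg_near_cst; near=> n.
have n0 : (0 < n)%N by near: n; exact: nbhs_infty_gt.
rewrite /pseries /series/= -(prednK n0) big_nat_recl// expr0 mulr1 big1 ?addr0// => i _.
by rewrite expr0n mulr0.
Unshelve. all: by end_near. Qed.

Lemma psumZ c z (w : R) : entire c -> psum (fun k => w * c k) z = w * psum c z.
Proof.
move=> rc; apply: psum_cvg.
have -> : pseries (fun k => w * c k) z = (fun n => w * pseries c z n).
  apply/funext => n; rewrite /pseries /series/= mulr_sumr.
  by apply: eq_bigr => i _; rewrite mulrA.
by apply: cvgM; [exact: cvg_cst|exact: cvg_psum].
Qed.

Lemma psum_sum N (w : nat -> R) (c : nat -> nat -> R) z : (forall r, entire (c r)) ->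
  psum (fun k => \sum_(r < N) w r * c r k) z = \sum_(r < N) w r * psum (c r) z.
Proof.
move=> rc; apply: psum_cvg.
have -> : pseries (fun k => \sum_(r < N) w r * c r k) z =
    (fun n => \sum_(r < N) w r * pseries (c r) z n).
  apply/funext => n; rewrite /pseries /series/=.
  under [RHS]eq_bigr do rewrite mulr_sumr.
  rewrite exchange_big/=; apply: eq_bigr => i _.
  by rewrite mulr_suml; apply: eq_bigr => r _; rewrite mulrA.
elim: N => [|N IH].
  rewrite big_ord0; under eq_cvg do rewrite big_ord0; exact: cvg_cst.
rewrite big_ord_recr/=; under eq_cvg do rewrite big_ord_recr/=.
by apply: cvgD => //; apply: cvgM; [exact: cvg_cst|exact: cvg_psum].
Qed.

Variables (lambda alpha nu : R).
Hypotheses (alpha_gt0 : 0 < alpha) (alpha_le1 : alpha <= 1).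
Hypotheses (nu_gt0 : 0 < nu) (nu_le1 : nu <= 1).

(** The sign and the factorial that stand in front of the series in [stfpp_prob]
are put into the coefficients. *)
Definition stfpp_coef n k : R :=
  (-1) ^+ n * gbinom (k%:R * nu) n * (- lambda `^ nu) ^+ k.

Lemma stfpp_coef_bound n : geom_bounded (stfpp_coef n).
Proof.
exists (n.+1%:R ^+ n), (2 ^+ n * `|- lambda `^ nu|) => k.
rewrite /stfpp_coef /gbinom !normrM normrX normrN1 expr1n mul1r normrX exprMn mulrA.
rewrite ler_wpM2r ?exprn_ge0//.
apply: le_trans (falling_bound nu n k (ltW nu_gt0) nu_le1).
rewrite ler_piMr// normfV normr_nat invf_le1 ?ler1n ?ltr0n fact_gt0//.
Qed.

Lemma stfpp_termE n t k : (-1) ^+ n / n`!%:R * stfpp_term lambda alpha nu n t k =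
  stfpp_coef n k / Gamma (k%:R * alpha + 1) * (t `^ alpha) ^+ k.
Proof.
rewrite /stfpp_term Gamma_rGamma; last by rewrite ltr_wpDl// mulr_ge0// ltW.
rewrite /stfpp_coef /gbinom exprMn.
move: ((-1) ^+ n) (n`!%:R)^-1 (falling _ _) (_ ^+ k) (Gamma _)^-1 (_ ^+ k) => A B C D E F.
ring.
Qed.

Definition stfpp_psum n t :=
  psum (fun k => stfpp_coef n k / Gamma (k%:R * alpha + 1)) (t `^ alpha).

Lemma entire_stfpp n : entire (fun k => stfpp_coef n k / Gamma (k%:R * alpha + 1)).
Proof. apply: geom_bounded_entire_Gamma => //; exact: stfpp_coef_bound. Qed.

Let sgn_fact_neq0 n : (-1) ^+ n / n`!%:R != 0 :> R.
Proof. by rewrite mulf_neq0// ?signr_eq0// invr_eq0 pnatr_eq0 -lt0n fact_gt0. Qed.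

Lemma stfpp_seriesE n t : series (stfpp_term lambda alpha nu n t) =
  (fun N => ((-1) ^+ n / n`!%:R)^-1 *
     pseries (fun k => stfpp_coef n k / Gamma (k%:R * alpha + 1)) (t `^ alpha) N).
Proof.
apply/funext => N; rewrite /pseries /series/= mulr_sumr; apply: eq_bigr => k _.
by rewrite -stfpp_termE mulKf.
Qed.

Lemma stfpp_series_cvg n t : series (stfpp_term lambda alpha nu n t) @ \oo -->
  ((-1) ^+ n / n`!%:R)^-1 * stfpp_psum n t.
Proof.
rewrite stfpp_seriesE; apply: cvgM; first exact: cvg_cst.
by apply: cvg_psum; exact: entire_stfpp.
Qed.

Lemma stfpp_probE n : stfpp_prob lambda alpha nu n = stfpp_psum n.
Proof.
apply/funext => t; rewrite /stfpp_prob.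
have /cvg_lim -> // := stfpp_series_cvg n t.
by rewrite mulVKf.
Qed.

(** The system of equations, read on the coefficients. *)
Lemma stfpp_coefS n k : stfpp_coef n k.+1 =
  - lambda `^ nu * \sum_(r < n.+1) (-1) ^+ r * gbinom nu r * stfpp_coef (n - r) k.
Proof.
rewrite {1}/stfpp_coef -natr1 mulrDl mul1r addrC -gbinom_Vandermonde.
rewrite mulr_sumr mulr_suml mulr_sumr; apply: eq_bigr => r _.
have rn : (r <= n)%N by rewrite -ltnS.
rewrite /stfpp_coef exprS.
have -> : (-1) ^+ n = (-1) ^+ r * (-1) ^+ (n - r) :> R by rewrite -exprD subnKC.
move: ((-1) ^+ r) ((-1) ^+ (n - r)) (gbinom nu r) (gbinom _ (n - r)%N) => A B C D.
move: (- lambda `^ nu) (_ ^+ k) => E F; ring.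
Qed.

Lemma stfpp_psum_caputo n t : 0 < t ->
  caputo alpha (stfpp_psum n) t = - lambda `^ nu *
    \sum_(r < n.+1) (-1) ^+ r * (falling nu r / r`!%:R) * stfpp_psum (n - r) t.
Proof.
move=> t0; rewrite caputo_psum_powR//; last exact: stfpp_coef_bound.
have entire_nr r : entire (fun k =>
    - lambda `^ nu * (stfpp_coef (n - r) k / Gamma (k%:R * alpha + 1))).
  have -> : (fun k =>
        - lambda `^ nu * (stfpp_coef (n - r) k / Gamma (k%:R * alpha + 1))) =
     (fun k => (- lambda `^ nu * stfpp_coef (n - r) k) / Gamma (k%:R * alpha + 1)).
    by apply/funext => k; rewrite mulrA.
  apply: geom_bounded_entire_Gamma => //.
  have [C [D H]] := stfpp_coef_bound (n - r).
  exists (`|- lambda `^ nu| * C), D => k.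
  by rewrite normrM -mulrA ler_wpM2l.
transitivity (psum (fun k => \sum_(r < n.+1) ((-1) ^+ r * gbinom nu r) *
   (- lambda `^ nu * (stfpp_coef (n - r) k / Gamma (k%:R * alpha + 1)))) (t `^ alpha)).
  congr psum; apply/funext => k; rewrite stfpp_coefS -mulrA mulr_suml mulr_sumr.
  by apply: eq_bigr => r _; rewrite -[X in _ * X]mulrA mulrCA.
rewrite (psum_sum n.+1 (fun r => (-1) ^+ r * gbinom nu r)
   (fun r k => - lambda `^ nu * (stfpp_coef (n - r) k / Gamma (k%:R * alpha + 1)))) //.
rewrite mulr_sumr; apply: eq_bigr => r _.
by rewrite psumZ; [rewrite mulrCA | exact: entire_stfpp].
Qed.

Lemma stfpp_psum_solution : is_solution lambda alpha nu stfpp_psum.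
Proof.
have init n : stfpp_psum n 0 = (-1) ^+ n * gbinom 0 n.
  rewrite /stfpp_psum powR0 ?gt_eqF// psum0 mul0r add0r Gamma1 divr1.
  by rewrite /stfpp_coef mul0r expr0 mulr1.
split.
- by move=> n; apply: admissible_psum_powR => //; exact: entire_stfpp.
- exact: stfpp_psum_caputo.
- by rewrite init gbinom0 mulr1.
- case=> // n _; rewrite init /gbinom /falling big_ord_recl.
  by rewrite subr0 !mul0r mulr0.
Qed.

End Solution.

(** * Uniqueness *)

Section Uniqueness.
Context {R : realType}.
Variables (lambda alpha nu : R).
Hypotheses (lambda_gt0 : 0 < lambda).
Hypotheses (alpha_gt0 : 0 < alpha) (alpha_le1 : alpha <= 1).

(** When the components of lower index agree, all terms of the sum but the one
with [r = 0] cancel in the equation of [p n - q n], which becomes a relaxation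
equation. *)
Lemma solution_le (p q : nat -> R -> R) n t :
  is_solution lambda alpha nu p -> is_solution lambda alpha nu q ->
  (forall m s, (m < n)%N -> 0 <= s -> p m s = q m s) ->
  0 <= t -> p n t <= q n t.
Proof.
move=> [ap ep p0 pS] [aq eq q0 qS] IH t0; rewrite -subr_le0.
apply: (relaxation_le0 (fun s => p n s - q n s) alpha (lambda `^ nu)) t0 => //.
- exact: admissibleB.
- exact: powR_gt0.
- by case: n {IH} => [|n]; rewrite ?p0 ?q0 ?pS ?qS// subrr.
move=> s s0; rewrite caputoB// ep// eq// -mulrBr mulNr; congr (- (_ * _)).
rewrite -sumrB big_ord_recl/= big1 ?addr0; last first.
  move=> i _; rewrite -mulrBr IH ?subrr ?mulr0//; last exact: ltW.
  by rewrite /bump/= ltn_subrL; case: n i {IH} => [[]|].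
by rewrite /falling big_ord0 fact0 divr1 expr0 !mul1r subn0.
Qed.

Lemma solution_unique (p q : nat -> R -> R) :
  is_solution lambda alpha nu p -> is_solution lambda alpha nu q ->
  forall n t, 0 <= t -> p n t = q n t.
Proof.
move=> sp sq n; elim/ltn_ind: n => n IH t t0; apply/le_anti/andP; split.
- by apply: solution_le => // m s mn s0; exact: IH.
- by apply: solution_le => // m s mn s0; rewrite IH.
Qed.
End Uniqueness.

Theorem theorem3p1 (R : realType) (lambda alpha nu : R)
    (lambda_gt0 : 0 < lambda)
    (alpha_gt0 : 0 < alpha) (alpha_le1 : alpha <= 1)
    (nu_gt0 : 0 < nu) (nu_le1 : nu <= 1) :
  [/\ forall (n : nat) (t : R), 0 <= t ->
        cvgn (series (stfpp_term lambda alpha nu n t)),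
      is_solution lambda alpha nu (stfpp_prob lambda alpha nu) &
      forall p : nat -> R -> R, is_solution lambda alpha nu p ->
        forall (n : nat) (t : R), 0 <= t -> p n t = stfpp_prob lambda alpha nu n t].
Proof.
have sol : is_solution lambda alpha nu (stfpp_prob lambda alpha nu).
  rewrite (_ : stfpp_prob lambda alpha nu = stfpp_psum lambda alpha nu).
    exact: stfpp_psum_solution.
  by apply/funext => n; exact: stfpp_probE.
split => //.
- move=> n t _; apply/cvg_ex; eexists.
  exact: (stfpp_series_cvg lambda alpha nu alpha_gt0 nu_gt0 nu_le1 n t).
- by move=> p sp n t t0; apply: (solution_unique lambda alpha nu).
Qed.
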